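(* Let $G$ be a torsion-free abelian group and let $(R,\mathfrak{m})$ be a $G$-graded domain that is a gr-local graded perinormal domain with graded maximal ideal $\mathfrak{m}$. Let $S$ be a graded overring of $R$ that satisfies gGD over $R$ and such that there exists $P\in h\text{-Spec}(S)$ with $P\cap R=\mathfrak{m}$. Then $S=R$.
   Context: A $G$-graded domain is an integral domain $R=\bigoplus_{\alpha\in G}R_\alpha$ with each $R_\alpha$ an additive subgroup and $R_\beta R_\gamma\subseteq R_{\beta+\gamma}$. Its graded quotient field is $R_H$, where $H$ is the set of nonzero homogeneous elements; $f/g$ (with $f,g$ homogeneous, $g\neq0$) has degree $\deg f-\deg g$. A graded overring of $R$ is a graded subring of $R_H$ containing $R$. $h\text{-Spec}$ denotes the set of graded (homogeneous) prime ideals. A graded maximal ideal is an ideal maximal among proper graded ideals; a graded domain is gr-local if it has exactly one graded maximal ideal. A graded overring $S$ of $R$ satisfies gGD (graded going-down) if whenever $P,Q\in h\text{-Spec}(R)$ and $\tilde Q\in h\text{-Spec}(S)$ with $P\subseteq Q$ and $\tilde Q\cap R=Q$, there exists $\tilde P\in h\text{-Spec}(S)$ with $\tilde P\subseteq\tilde Q$ and $\tilde P\cap R=P$. A $G$-graded domain $R$ is a graded perinormal domain if every gr-local graded overring of $R$ satisfying gGD over $R$ is a localization of $R$ (i.e. equals $R_W$ for some multiplicative subset $W$ of $R$). *)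

(* Defs.v *)
From HB Require Import structures.
From mathcomp Require Import all_boot all_algebra.
From mathcomp Require Import boolp classical_sets.

Set Implicit Arguments.
Unset Strict Implicit.
Unset Printing Implicit Defensive.

Import GRing.Theory.
Local Open Scope classical_set_scope.
Local Open Scope ring_scope.

Local Notation "x %:F" := (@FracField.tofrac _ x) : ring_scope.

Definition torsion_free (G : zmodType) : Prop :=
  forall (n : nat) (x : G), (0 < n)%N -> x *+ n = 0 -> x = 0.

(* For the components of a graded ring and an additive subgroup A this says
   that A is the sum of its subgroups A `&` comp a. *)
Definition is_graded_subset (G : zmodType) (V : zmodType) (comp : G -> set V)
    (A : set V) : Prop :=
  forall x, A x -> exists (s : seq G) (c : G -> V),
    [/\ uniq s, forall a, a \in s -> (A `&` comp a) (c a)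
      & x = \sum_(a <- s) c a].

Record grading (G : zmodType) (R : nzRingType) := Grading {
  gr_comp :> G -> set R;
  gr_zmod : forall a, zmod_closed [in gr_comp a];
  gr_mul : forall b c x y,
    gr_comp b x -> gr_comp c y -> gr_comp (b + c) (x * y);
  gr_span : is_graded_subset gr_comp [set: R];
  gr_direct : forall (s : seq G) (c : G -> R), uniq s ->
    (forall a, gr_comp a (c a)) -> \sum_(a <- s) c a = 0 ->
    forall a, a \in s -> c a = 0
}.

(* R as a subring of its quotient field. All overrings of R, their ideals and
   the ideals of R itself are subsets of {fraction R}, so that contraction to R
   is intersection. *)
Definition base_ring (R : idomainType) : set {fraction R} :=
  [set r%:F | r in [set: R]].
Arguments base_ring : clear implicits.

(* The component of degree a of the graded quotient field R_H. *)
Definition qcomp (G : zmodType) (R : idomainType) (gr : grading G R) (a : G) :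
    set {fraction R} :=
  [set x | exists b c (f g : R),
     [/\ gr b f, gr c g, g != 0, a = b - c & x = f%:F / g%:F]].

Definition gr_quotient_field (G : zmodType) (R : idomainType)
    (gr : grading G R) : set {fraction R} :=
  [set x | exists r h : R,
     [/\ h != 0, exists a, gr a h & x = r%:F / h%:F]].

(* Directness of the decomposition of S, and compatibility with products, are
   inherited from the grading of R_H. *)
Definition graded_overring (G : zmodType) (R : idomainType) (gr : grading G R)
    (S : set {fraction R}) : Prop :=
  [/\ subring_closed [in S], base_ring R `<=` S, S `<=` gr_quotient_field gr
    & is_graded_subset (qcomp gr) S].

Definition ideal_of (K : comNzRingType) (S I : set K) : Prop :=
  [/\ zmod_closed [in I], I `<=` S & forall a x, S a -> I x -> I (a * x)].

Definition graded_ideal (G : zmodType) (R : idomainType) (gr : grading G R)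
    (S I : set {fraction R}) : Prop :=
  ideal_of S I /\ is_graded_subset (qcomp gr) I.

Definition hSpec (G : zmodType) (R : idomainType) (gr : grading G R)
    (S : set {fraction R}) : set (set {fraction R}) :=
  [set P | [/\ graded_ideal gr S P, P <> S
    & forall x y, S x -> S y -> P (x * y) -> P x \/ P y]].

Definition graded_maximal (G : zmodType) (R : idomainType) (gr : grading G R)
    (S M : set {fraction R}) : Prop :=
  [/\ graded_ideal gr S M, M <> S
    & forall I, graded_ideal gr S I -> I <> S -> M `<=` I -> I = M].

Definition gr_local (G : zmodType) (R : idomainType) (gr : grading G R)
    (S : set {fraction R}) : Prop :=
  exists! M, graded_maximal gr S M.

Definition gGD (G : zmodType) (R : idomainType) (gr : grading G R)
    (S : set {fraction R}) : Prop :=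
  forall P Q Q', hSpec gr (base_ring R) P -> hSpec gr (base_ring R) Q ->
    hSpec gr S Q' -> P `<=` Q -> Q' `&` base_ring R = Q ->
    exists P', [/\ hSpec gr S P', P' `<=` Q' & P' `&` base_ring R = P].

Definition multiplicative_subset (R : idomainType) (W : set R) : Prop :=
  mulr_closed [in W] /\ ~ W 0.

Definition localization (R : idomainType) (W : set R) : set {fraction R} :=
  [set x | exists r w : R, W w /\ x = r%:F / w%:F].

Definition graded_perinormal (G : zmodType) (R : idomainType)
    (gr : grading G R) : Prop :=
  forall S, graded_overring gr S -> gr_local gr S -> gGD gr S ->
    exists W : set R, multiplicative_subset W /\ S = localization W.

(* Main.v *)
Require Import Defs.
From mathcomp Require Import all_boot all_algebra.
From mathcomp Require Import boolp classical_sets.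

(** Let [P] be the graded prime of [S] over [m], and let [T] be the localization
    of [S] at the homogeneous elements outside [P]. Then [T] is a graded
    overring of [R] with [P T] as its only graded maximal ideal
    ([hfrac_overring], [hfrac_local]). It inherits going-down from [S], because
    its graded primes are those of [S] contained in [P] ([hfrac_gGD]).
    Perinormality gives [T = R_W] for some multiplicative set [W], and it is
    enough to show that every [w] in [W] is a unit of [R]: then
    [S] is contained in [T = R].

    Two facts about [w] give this. As [w^-1] lies in [T], the element [w] is
    not in [P], hence not in [m]. Moreover [w^-1] lies in the graded
    quotient field, so [w] divides a nonzero homogeneous element of [R]; since the
    grading group is torsion-free, such a divisor is itself homogeneous
    ([homogeneous_factor]). A homogeneous nonunit would generate a proper graded
    ideal, which lies in a graded maximal ideal, that is in [m]
    ([homogeneous_unit]). So [w] is a unit.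

    Homogeneity of factors is the usual comparison of highest and lowest
    degrees. A torsion-free abelian group can be totally ordered, but here a
    partial order comparing the finitely many degrees that occur suffices; it is
    given by its set of positive elements ([strict_cone_total]). *)

Set Implicit Arguments.
Unset Strict Implicit.
Unset Printing Implicit Defensive.

Import GRing.Theory.
Local Open Scope classical_set_scope.
Local Open Scope ring_scope.

Local Notation "x %:F" := (@FracField.tofrac _ x) : ring_scope.

(** * Strict positive cones in torsion-free groups *)

(** The positive elements of a translation-invariant strict partial order on [G],
    in which [a < b] means [C (b - a)]. *)
Definition strict_cone (G : zmodType) (C : set G) : Prop :=
  ~ C 0 /\ forall a b, C a -> C b -> C (a + b).

Lemma strict_coneMn (G : zmodType) (C : set G) (n : nat) (a : G) :
  strict_cone C -> (0 < n)%N -> C a -> C (a *+ n).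
Proof.
case=> _ CD; case: n => // n _ Ca.
by elim: n => [|n IHn]; rewrite ?mulr1n // mulrS; apply: CD.
Qed.

(** A cone extends by either [d] or [- d]: if both extensions contained [0],
    then [c = - (d *+ n)] and [c' = d *+ n'] with [c], [c'] in the cone (or
    zero), and [c *+ n' + c' *+ n = 0] would contradict strictness. *)
Lemma strict_cone_extend (G : zmodType) (C : set G) (d : G) :
  torsion_free G -> strict_cone C -> d != 0 ->
  exists C' : set G, [/\ strict_cone C', C `<=` C' & C' d \/ C' (- d)].
Proof.
move=> tfG Ccone d0; have [C0 CD] := Ccone.
(* [E e] is the semigroup generated by [C] and [e]. *)
pose E e := [set x : G | C x \/
  exists2 n, (0 < n)%N & x = e *+ n \/ exists2 c, C c & x = c + e *+ n].
have ED e a b : E e a -> E e b -> E e (a + b).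
  case=> [Ca|[n n0 [->|[c Cc ->]]]]; case=> [Cb|[k k0 [->|[c' Cc' ->]]]].
  - by left; apply: CD.
  - by right; exists k => //; right; exists a.
  - by right; exists k => //; right; exists (a + c'); rewrite ?addrA//; apply: CD.
  - by right; exists n => //; right; exists b; rewrite // addrC.
  - by right; exists (n + k)%N; rewrite ?addn_gt0 ?n0//; left; rewrite mulrnDr.
  - right; exists (n + k)%N; rewrite ?addn_gt0 ?n0//; right; exists c' => //.
    by rewrite mulrnDr addrCA.
  - by right; exists n => //; right; exists (b + c);
      [apply: CD | rewrite addrAC (addrC b)].
  - right; exists (n + k)%N; rewrite ?addn_gt0 ?n0//; right; exists c => //.
    by rewrite mulrnDr addrA.
  - right; exists (n + k)%N; rewrite ?addn_gt0 ?n0//; right; exists (c + c').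
      exact: CD.
    by rewrite mulrnDr addrACA.
have CE e : C `<=` E e by move=> x Cx; left.
have Ee e : E e e by right; exists 1%N => //; left.
have E0 e : e != 0 -> E e 0 -> exists n, (0 < n)%N /\ C (- (e *+ n)).
  move=> e0 [//|[n n0 [en0|[c Cc cn]]]].
    by case/eqP: e0; apply: tfG n0 _.
  by exists n; split=> //; rewrite (_ : - _ = c)//; apply: (addIr (e *+ n));
     rewrite addNr.
have [Ed0|Ed0] := pselect (E d 0); last first.
  by exists (E d); split; [split => // a b; apply: ED| exact: CE | left].
exists (E (- d)); split; [split => [End0|a b]|exact: CE|by right].
  have [n [n0 Cn]] := E0 _ d0 Ed0.
  have [|k [k0 Ck]] := E0 (- d) _ End0; first by rewrite oppr_eq0.
  apply: C0; have := CD _ _ (strict_coneMn Ccone k0 Cn) (strict_coneMn Ccone n0 Ck).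
  by rewrite !mulNrn opprK -!mulrnA mulnC addNr.
exact: ED.
Qed.

(** Only finitely many differences of degrees ever have to be compared, so
    finitely many extension steps replace a total order on the group. *)
Lemma strict_cone_total (G : zmodType) (D : seq G) :
  torsion_free G ->
  exists C : set G, strict_cone C /\
    forall d, d \in D -> d != 0 -> C d \/ C (- d).
Proof.
move=> tfG; elim: D => [|e D [C [Ccone CD]]].
  by exists set0; split => //; split.
have [->|e0] := eqVneq e 0.
  exists C; split=> // d; rewrite inE => /orP[/eqP->|/CD//].
  by rewrite eqxx.
have [C' [C'cone sub C'e]] := strict_cone_extend tfG Ccone e0.
exists C'; split=> // d; rewrite inE => /orP[/eqP->//|/CD h /h[]/sub]; tauto.
Qed.

(** * Sums of homogeneous elements *)

Section Span.
Variables (G V : zmodType) (comp : G -> set V).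

(** Terms of equal degree may repeat in [l], which makes closure under addition
    and multiplication a matter of lists. *)
Definition hspan (D : set G) : set V := [set x | exists l : seq (G * V),
  (forall p, p \in l -> D p.1 /\ comp p.1 p.2) /\ x = \sum_(p <- l) p.2].

Lemma hspanS (D E : set G) : D `<=` E -> hspan D `<=` hspan E.
Proof. by move=> DE x [l [lD ->]]; exists l; split=> // p /lD[/DE]. Qed.

Lemma hspanD D x y : hspan D x -> hspan D y -> hspan D (x + y).
Proof.
move=> [l [lD ->]] [k [kD ->]]; exists (l ++ k); rewrite big_cat; split=> // p.
by rewrite mem_cat => /orP[/lD|/kD].
Qed.

Lemma hspan1 (D : set G) a x : D a -> comp a x -> hspan D x.
Proof.
move=> Da ax; exists [:: (a, x)]; rewrite big_seq1; split=> // p.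
by rewrite inE => /eqP->.
Qed.

Lemma hspan_sum D (s : seq G) (c : G -> V) :
  (forall a, a \in s -> D a /\ comp a (c a)) -> hspan D (\sum_(a <- s) c a).
Proof.
move=> sD; exists [seq (a, c a) | a <- s]; rewrite big_map; split=> // p.
by case/mapP=> a /sD ? ->.
Qed.

Hypothesis comp_zmod : forall a, zmod_closed [in comp a].

Lemma comp0 a : comp a 0.
Proof. by have [] := comp_zmod a; rewrite inE. Qed.

Lemma compB a x y : comp a x -> comp a y -> comp a (x - y).
Proof. by have [_ h] := comp_zmod a => ax ay; have := h x y; rewrite !inE; apply. Qed.

Lemma compN a x : comp a x -> comp a (- x).
Proof. by move=> ax; rewrite -sub0r; apply: compB => //; apply: comp0. Qed.

Lemma compD a x y : comp a x -> comp a y -> comp a (x + y).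
Proof. by move=> ax /compN; rewrite -{2}[y]opprK; apply: compB. Qed.

Lemma hspanN D x : hspan D x -> hspan D (- x).
Proof.
move=> [l [lD ->]]; exists [seq (p.1, - p.2) | p <- l].
rewrite big_map sumrN; split=> // p /mapP[q /lD[? ?] ->]; split=> //=.
exact: compN.
Qed.

Hypothesis comp_direct : forall (s : seq G) (c : G -> V), uniq s ->
    (forall a, comp a (c a)) -> \sum_(a <- s) c a = 0 ->
    forall a, a \in s -> c a = 0.

(** Directness only speaks of sums over distinct degrees, so the terms of equal
    degree are first collected. *)
Lemma hspan_homog0 (D : set G) a x : comp a x -> hspan D x -> ~ D a -> x = 0.
Proof.
move=> ax [l [lD xE]] Da; pose k := (a, - x) :: l.
have kP p : p \in k -> comp p.1 p.2.
  by rewrite inE => /orP[/eqP->|/lD[]//]; apply: compN.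
pose c b := \sum_(p <- k | p.1 == b) p.2.
have ccomp b : comp b (c b).
  rewrite /c big_seq_cond; apply: (big_ind (comp b)) => [|u v|p].
  - exact: comp0.
  - exact: compD.
  - by case/andP=> /kP + /eqP<-.
have ca : c a = - x.
  rewrite /c big_cons eqxx big_seq_cond big1 ?addr0// => p /andP[/lD[]].
  by move=> + _ /eqP pa; rewrite pa.
apply/eqP; rewrite -oppr_eq0 -ca; apply/eqP.
pose s := undup [seq p.1 | p <- k].
apply: (@comp_direct s c) => //; first exact: undup_uniq; last first.
  by rewrite mem_undup inE eqxx.
rewrite /c; under eq_bigr do rewrite big_mkcond.
rewrite exchange_big /= big_seq (eq_bigr snd) => [|p pk].
  by rewrite -big_seq big_cons -xE addNr.
have ps : p.1 \in s by rewrite mem_undup map_f.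
rewrite (bigD1_seq p.1) ?undup_uniq//= eqxx big1 ?addr0// => b.
by rewrite eq_sym => /negPf->.
Qed.

(** By directness, the components of [x] in [A] and in [B] are the same, hence
    lie in both. *)
Lemma graded_subsetI (A B : set V) : A 0 -> B 0 ->
  is_graded_subset comp A -> is_graded_subset comp B ->
  is_graded_subset comp (A `&` B).
Proof.
move=> A0 B0 grA grB x [Ax Bx].
have [s [c [us sA xc]]] := grA x Ax; have [t [d [ut tB xd]]] := grB x Bx.
exists s, c; split=> // a a_s; have [Aca aca] := sA a a_s.
suff Bca : B (c a) by split.
have [a_t|ta] := boolP (a \in t).
  have [Bda ada] := tB a a_t; suff -> : c a = d a by [].
  apply/eqP; rewrite -subr_eq0; apply/eqP.
  apply: (@hspan_homog0 [set b | b != a] a) => [||/= /eqP//]; first exact: compB.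
  suff -> : c a - d a = \sum_(b <- t | b != a) d b - \sum_(b <- s | b != a) c b.
    apply: hspanD; last apply: hspanN; rewrite -big_filter; apply: hspan_sum => b.
      by rewrite mem_filter => /andP[ba /tB[]].
    by rewrite mem_filter => /andP[ba /sA[]].
  move: xd; rewrite xc (bigD1_seq a)//= (bigD1_seq a a_t)//= => e.
  by apply/eqP; rewrite subr_eq addrAC -subr_eq opprK addrC -addrC e addrC.
suff -> : c a = 0 by [].
apply: (@hspan_homog0 [set b | b != a] a) => [//||/= /eqP//].
have -> : c a = \sum_(b <- t) d b - \sum_(b <- s | b != a) c b.
  by rewrite -xd xc (bigD1_seq a)//= addrK.
apply: hspanD; last apply: hspanN.
  by apply: hspan_sum => b bt; split; [apply: contraNneq ta => <-|case: (tB b bt)].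
rewrite -big_filter; apply: hspan_sum => b.
by rewrite mem_filter => /andP[ba /sA[]].
Qed.

End Span.

(** * Factors of homogeneous elements *)

Section Leading.
Variables (G : zmodType) (R : idomainType) (gr : grading G R).

Lemma gr_decomp (x : R) : exists (s : seq G) (c : G -> R),
  [/\ uniq s, forall a, a \in s -> gr a (c a) /\ c a != 0 & x = \sum_(a <- s) c a].
Proof.
have [|s [c [us sc ->]]] := gr_span gr (x := x); first by [].
exists [seq a <- s | c a != 0], c; split; first exact: filter_uniq.
  by move=> a; rewrite mem_filter => /andP[-> /sc[]].
rewrite big_filter [LHS](bigID (fun a => c a != 0))/= [X in _ + X]big1 ?addr0//.
by move=> a /negPn/eqP.
Qed.

Lemma gr_nonzero : exists d (h : R), gr d h /\ h != 0.
Proof.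
have [[|a s] [c [_ sc]]] := gr_decomp 1.
  by rewrite big_nil => /eqP; rewrite oner_eq0.
by exists a, (c a); apply: sc; rewrite inE eqxx.
Qed.

Lemma hspanM (D E F : set G) (x y : R) :
  (forall a b, D a -> E b -> F (a + b)) ->
  hspan gr D x -> hspan gr E y -> hspan gr F (x * y).
Proof.
move=> DEF [l [lD ->]] [k [kE ->]].
exists [seq (p.1 + q.1, p.2 * q.2) | p <- l, q <- k]; split=> [p|].
  case/allpairsP=> -[p' q'] [/lD[Dp pp] /kE[Eq qq] ->] /=.
  by split; [apply: DEF | apply: gr_mul].
rewrite big_allpairs_dep mulr_suml; apply: eq_bigr => p _.
by rewrite mulr_sumr.
Qed.

(** [a] is the highest degree of [x] for the order defined by [C]; for the
    opposite cone it is the lowest one. *)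
Definition leading (C : set G) (a : G) (x : R) : Prop := exists f x',
  [/\ gr a f, f != 0, hspan gr [set b | C (a - b)] x' & x = f + x'].

Lemma leadingM (C : set G) a b x y : strict_cone C ->
  leading C a x -> leading C b y -> leading C (a + b) (x * y).
Proof.
move=> [_ CD] [f [x' [af f0 hx ->]]] [g [y' [bg g0 hy ->]]].
exists (f * g), (f * y' + x' * g + x' * y'); split.
- exact: gr_mul.
- exact: mulf_neq0.
- apply: hspanD; first apply: hspanD.
  + apply: hspanM hy; last by apply: (@hspan1 _ _ _ [set a] a).
    by move=> _ c -> /=; rewrite opprD addrACA subrr add0r.
  + apply: hspanM hx _; last by apply: (@hspan1 _ _ _ [set b] b).
    by move=> c _ /= h ->; rewrite opprD addrACA subrr addr0.
  + apply: hspanM hx hy => c e /= h1 h2; rewrite opprD addrACA; exact: CD.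
- by rewrite mulrDl !mulrDr !addrA.
Qed.

(** If [a] and [b] are distinct leading degrees, directness forces the leading
    term of degree [a] to occur among the lower terms of the other
    decomposition, so [a < b]; by symmetry [b < a]. *)
Lemma leading_inj (C : set G) a b x : strict_cone C ->
  leading C a x -> leading C b x -> a = b.
Proof.
move=> [C0 CD] la lb; apply: contrapT => ab.
suff gap u v : leading C u x -> leading C v x -> u <> v -> C (v - u).
  apply: C0; have := CD _ _ (gap _ _ la lb ab) (gap _ _ lb la (nesym ab)).
  by rewrite addrA subrK subrr.
move=> [f [x' [uf f0 hx ->]]] [g [y' [vg g0 hy e]]] uv.
apply: contrapT => Cvu; move/eqP: f0; apply.
have -> : f = g + y' - x' by rewrite -e addrK.
pose D := [set w | w != u].
apply: (@hspan_homog0 _ _ _ (gr_zmod gr) (@gr_direct _ _ gr) D u) => [||/eqP//].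
  by rewrite -[g + y']e addrK.
apply: hspanD; first apply: hspanD.
- by apply: (hspan1 _ vg); apply/eqP => vu; apply: uv.
- by apply: hspanS hy => w /= h; apply: contra_notN Cvu => /eqP<-.
- apply: hspanN; first exact: gr_zmod.
  by apply: hspanS hx => w /= h; apply: contra_notN C0 => /eqP uw;
    rewrite -(subrr u) -{2}uw.
Qed.

Lemma leading_homog (C : set G) a f : gr a f -> f != 0 -> leading C a f.
Proof.
move=> af f0; exists f, 0; split; rewrite ?addr0//.
by exists [::]; rewrite big_nil.
Qed.

Lemma exists_max (C : set G) (s : seq G) : strict_cone C ->
  {in s &, forall a b, a != b -> C (a - b) \/ C (b - a)} -> s != [::] ->
  exists2 M, M \in s & {in s, forall b, b != M -> C (M - b)}.
Proof.
move=> [_ CD]; elim: s => // a s IHs tot _.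
have [->|s0] := eqVneq s [::].
  by exists a; rewrite ?inE// => b; rewrite inE => /eqP->; rewrite eqxx.
have [|M Ms maxM] := IHs _ s0.
  by move=> b c bs cs; apply: tot; rewrite inE ?bs ?cs orbT.
have [aM|aM] := eqVneq a M.
  exists M; first by rewrite inE Ms orbT.
  move=> b; rewrite inE => /orP[/eqP->|]; last exact: maxM.
  by rewrite aM eqxx.
have [||CaM|CMa] := tot a M _ _ aM; rewrite ?inE ?eqxx ?Ms ?orbT//.
  exists a; first by rewrite inE eqxx.
  move=> b; rewrite inE => /orP[/eqP->|bs ba]; first by rewrite eqxx.
  have [->//|/maxM - /(_ bs)/(CD _ _ CaM)] := eqVneq b M.
  by rewrite addrA subrK.
exists M; first by rewrite inE Ms orbT.
by move=> b; rewrite inE => /orP[/eqP->//|]; apply: maxM.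
Qed.

Lemma leading_max (C : set G) (s : seq G) (c : G -> R) M :
  uniq s -> (forall a, a \in s -> gr a (c a) /\ c a != 0) ->
  M \in s -> {in s, forall b, b != M -> C (M - b)} ->
  leading C M (\sum_(a <- s) c a).
Proof.
move=> us sc Ms maxM; exists (c M), (\sum_(a <- s | a != M) c a).
have [gM cM0] := sc M Ms; split=> //; last by rewrite (bigD1_seq M).
rewrite -big_filter; apply: hspan_sum => a; rewrite mem_filter => /andP[aM a_s].
by split; [apply: maxM|case: (sc a a_s)].
Qed.

(** A factor of a homogeneous element has a highest and a lowest degree; they
    add up to those of the product, which agree. Were the extreme degrees of
    [x] different, the sums of the extreme degrees would be different too. *)
Lemma homogeneous_factor d (x y : R) : torsion_free G ->
  gr d (x * y) -> x * y != 0 -> exists a, gr a x.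
Proof.
move=> tfG dxy xy0.
have [s [c [us sc xE]]] := gr_decomp x; have [t [e [ut te yE]]] := gr_decomp y.
(* The cone has to compare degrees within [s] and within [t] only. *)
have [C [Ccone Ctot]] := strict_cone_total
  ([seq a - b | a <- s, b <- s] ++ [seq a - b | a <- t, b <- t]) tfG.
have tots : {in s &, forall a b, a != b -> C (a - b) \/ C (b - a)}.
  move=> a b a_s bs ab; rewrite -[b - a]opprB; apply: Ctot; last by rewrite subr_eq0.
  by rewrite mem_cat (allpairs_f (fun u v => u - v)).
have tott : {in t &, forall a b, a != b -> C (a - b) \/ C (b - a)}.
  move=> a b a_s bs ab; rewrite -[b - a]opprB; apply: Ctot; last by rewrite subr_eq0.
  by rewrite mem_cat; apply/orP; right; apply: (allpairs_f (fun u v => u - v)).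
pose C' : set G := [set g | C (- g)].
have C'cone : strict_cone C'.
  case: (Ccone) => C0 CD; split; rewrite /C' /= ?oppr0// => a b /=.
  by rewrite opprD; apply: CD.
have tot' (u : seq G) : {in u &, forall a b, a != b -> C (a - b) \/ C (b - a)} ->
    {in u &, forall a b, a != b -> C' (a - b) \/ C' (b - a)}.
  by move=> h a b au bu ab; rewrite /C' /= !opprB; apply: h; rewrite // eq_sym.
have s0 : s != [::].
  by apply: contraNneq xy0 => s0; rewrite xE s0 big_nil mul0r.
have t0 : t != [::].
  by apply: contraNneq xy0 => t0; rewrite yE t0 big_nil mulr0.
have [M Ms maxM] := exists_max Ccone tots s0.
have [N Ns minN] := exists_max C'cone (tot' s tots) s0.
have [M' Mt maxM'] := exists_max Ccone tott t0.
have [N' Nt minN'] := exists_max C'cone (tot' t tott) t0.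
have dM : d = M + M'.
  apply: (leading_inj Ccone (leading_homog C dxy xy0)); rewrite xE yE.
  by apply: leadingM => //; apply: leading_max.
have dN : d = N + N'.
  apply: (leading_inj C'cone (leading_homog C' dxy xy0)); rewrite xE yE.
  by apply: leadingM => //; apply: leading_max.
have [C0 CD] := Ccone.
have NM : N = M.
  apply/eqP/negPn/negP => NM; have CNM := maxM N Ns NM.
  apply: C0; have [M'N'|M'N'] := eqVneq M' N'.
    move: dN; rewrite dM M'N' => /addIr MN.
    by rewrite MN eqxx in NM.
  have := maxM' N' Nt; rewrite eq_sym => /(_ M'N')/(CD _ _ CNM).
  by rewrite addrACA -opprD -dM -dN subrr.
have sM b : b \in s -> b = M.
  move=> bs; apply/eqP/negPn/negP => bM; apply: C0.
  have := minN b bs; rewrite NM => /(_ bM); rewrite /C' /= opprB => h.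
  by have := CD _ _ h (maxM b bs bM); rewrite addrA subrK subrr.
exists M; rewrite xE big_seq; apply: big_ind => [|u v|b /[dup] /sM bM bs].
- exact: (comp0 (gr_zmod gr)).
- exact: (compD (gr_zmod gr)).
- by rewrite -{1}bM; case: (sc b bs).
Qed.

End Leading.

(** * The graded quotient field *)

Section QuotientField.
Variables (G : zmodType) (R : idomainType) (gr : grading G R).

Lemma qcompM a b x y : qcomp gr a x -> qcomp gr b y -> qcomp gr (a + b) (x * y).
Proof.
move=> [a1 [a2 [f [g [af ag g0 -> ->]]]]] [b1 [b2 [f' [g' [bf bg g'0 -> ->]]]]].
exists (a1 + b1), (a2 + b2), (f * f'), (g * g'); split; try exact: gr_mul.
- exact: mulf_neq0.
- by rewrite opprD addrACA.
- by rewrite !tofracM invfM mulrACA.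
Qed.

Lemma qcompV a x : x != 0 -> qcomp gr a x -> qcomp gr (- a) x^-1.
Proof.
move=> x0 [a1 [a2 [f [g [af ag g0 -> xE]]]]].
exists a2, a1, g, f; split=> //; last by rewrite xE invf_div.
  by apply: contraNneq x0 => f0; rewrite xE f0 tofrac0 mul0r.
by rewrite opprB.
Qed.

Lemma qcomp_div a b x y : y != 0 -> qcomp gr a x -> qcomp gr b y ->
  qcomp gr (a - b) (x / y).
Proof. by move=> y0 ax /(qcompV y0); apply: qcompM. Qed.

Lemma qcomp1 : qcomp gr 0 1.
Proof.
have [d [h [dh h0]]] := gr_nonzero gr.
exists d, d, h, h; split; rewrite ?subrr// divff//.
by rewrite tofrac_eq0.
Qed.

(** Writing [r] as [(r * h) / h] avoids deciding the degree of [1] in [R]. *)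
Lemma qcomp_tofrac a r : gr a r -> qcomp gr a r%:F.
Proof.
have [d [h [dh h0]]] := gr_nonzero gr => ar.
exists (a + d), d, (r * h), h; split; rewrite ?addrK//; first exact: gr_mul.
by rewrite tofracM mulfK// tofrac_eq0.
Qed.

Lemma qcomp_zmod a : zmod_closed [in qcomp gr a].
Proof.
split; first by rewrite inE -tofrac0; apply: qcomp_tofrac; apply: comp0 (gr_zmod gr) a.
move=> x y; rewrite !inE.
move=> [a1 [a2 [f [g [af ag g0 -> ->]]]]] [b1 [b2 [f' [g' [bf bg g'0 ab ->]]]]].
exists (a1 + b2), (a2 + b2), (f * g' - f' * g), (g * g').
split; rewrite ?mulf_neq0//.
- apply: (compB (gr_zmod gr)); first exact: gr_mul.
  suff -> : a1 + b2 = b1 + a2 by apply: gr_mul.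
  by rewrite -[a1](subrK a2) ab addrAC subrK.
- exact: gr_mul.
- by rewrite opprD addrACA subrr addr0.
- by rewrite -mulNr addf_div ?tofrac_eq0// mulNr tofracB !tofracM.
Qed.

Lemma common_denominator (s : seq G) (c : G -> {fraction R}) :
  (forall a, qcomp gr a (c a)) ->
  exists d h, [/\ gr d h, h != 0 &
    forall a, a \in s -> exists2 r, gr (a + d) r & h%:F * c a = r%:F].
Proof.
move=> cc; elim: s => [|a s [d [h [dh h0 hs]]]].
  by have [d [h [dh h0]]] := gr_nonzero gr; exists d, h.
have [a1 [a2 [f [g [af ag g0 aE caE]]]]] := cc a.
exists (d + a2), (h * g); split; rewrite ?mulf_neq0//; first exact: gr_mul.
move=> b; rewrite inE => /orP[/eqP->|/hs[r br hr]]; last first.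
  exists (r * g); first by rewrite addrA; apply: gr_mul.
  by rewrite !tofracM mulrAC hr.
exists (h * f); first by rewrite aE addrCA subrK; apply: gr_mul.
by rewrite caE !tofracM -mulrA [_ * (_ / _)]mulrC divfK// tofrac_eq0.
Qed.

(** Multiplying by a common homogeneous denominator of degree [d] moves the
    relation into [R], with all degrees shifted by [d]. *)
Lemma qcomp_direct (s : seq G) (c : G -> {fraction R}) : uniq s ->
  (forall a, qcomp gr a (c a)) -> \sum_(a <- s) c a = 0 ->
  forall a, a \in s -> c a = 0.
Proof.
move=> us cc sum0; have [d [h [dh h0 hs]]] := common_denominator s cc.
have hF0 : h%:F != 0 by rewrite tofrac_eq0.
have /choice[r rP] a : exists r : R,
    gr (a + d) r /\ (a \in s -> h%:F * c a = r%:F).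
  have [/hs[r]|_] := boolP (a \in s); first by exists r.
  by exists 0; split=> //; apply: comp0 (gr_zmod gr) _.
move=> a a_s; apply: (mulfI hF0); rewrite mulr0 (rP a).2//.
rewrite -[a](addrK d); apply/eqP; rewrite tofrac_eq0; apply/eqP.
pose e b := r (b - d).
apply: (@gr_direct _ _ gr [seq b + d | b <- s] e).
- by rewrite map_inj_uniq//; apply: addIr.
- by move=> b; rewrite -{1}[b](subrK d); case: (rP (b - d)).
- apply/eqP; rewrite -tofrac_eq0 big_map rmorph_sum/=; apply/eqP.
  rewrite (eq_big_seq (fun b => h%:F * c b)) => [|b bs].
    by rewrite -mulr_sumr sum0 mulr0.
  by rewrite /e addrK (rP b).2.
- exact: map_f.
Qed.

End QuotientField.

(** * Graded ideals *)

Section GradedIdeals.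
Variables (G : zmodType) (R : idomainType) (gr : grading G R).
Variable S : set {fraction R}.
Hypothesis S1 : S 1.

Lemma ideal_ofP (I : set {fraction R}) : ideal_of S I <->
  [/\ I 0, forall x y, I x -> I y -> I (x - y), I `<=` S
    & forall a x, S a -> I x -> I (a * x)].
Proof.
split=> [[[I0 IB] IS IM]|[I0 IB IS IM]].
  split=> //; first by rewrite inE in I0.
  by move=> x y Ix Iy; have := IB x y; rewrite !inE; apply.
by split=> //; split; rewrite ?inE// => x y; rewrite !inE; apply: IB.
Qed.

Lemma ideal_proper (I : set {fraction R}) : ideal_of S I -> I <> S <-> ~ I 1.
Proof.
move=> /ideal_ofP[_ _ IS IM]; split=> [IneS I1|nI1 IS']; last first.
  by apply: nI1; rewrite IS'.
by apply: IneS; apply/seteqP; split=> // x Sx; rewrite -[x]mulr1; apply: IM.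
Qed.

(** Zorn's lemma: a union of a chain of graded ideals avoiding [1] is one. *)
Lemma exists_graded_maximal (I : set {fraction R}) :
  graded_ideal gr S I -> ~ I 1 -> exists2 M, graded_maximal gr S M & I `<=` M.
Proof.
move=> grI nI1.
(* The empty set is added so that the union of the empty chain qualifies. *)
pose good J := J = set0 \/ [/\ graded_ideal gr S J, ~ J 1 & I `<=` J].
have [|M [Mgood Mmax]] := @Zorn_bigcup _ good.
  move=> F Fgood Ftot.
  have [[J [FJ [j Jj]]]|Fempty] := pselect (exists J, F J /\ J !=set0); last first.
    left; apply/seteqP; split=> // x [J FJ Jx]; apply: Fempty.
    by exists J; split=> //; exists x.
  have F_good K x : F K -> K x -> [/\ graded_ideal gr S K, ~ K 1 & I `<=` K].
    by move=> FK Kx; case: (Fgood K FK) => // K0; rewrite K0 in Kx.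
  right; have [[/ideal_ofP[J0 JB JS JM] grJ] nJ1 IJ] := F_good J j FJ Jj.
  split; last by move=> x Ix; exists J => //; apply: IJ.
    split; first apply/ideal_ofP; first split.
    - by exists J.
    - move=> x y [K FK Kx] [L FL Ly].
      have [[/ideal_ofP[_ KB _ _] _] _ _] := F_good K x FK Kx.
      have [[/ideal_ofP[_ LB _ _] _] _ _] := F_good L y FL Ly.
      have [KL|LK] := Ftot K L FK FL.
        by exists L => //; apply: LB => //; apply: KL.
      by exists K => //; apply: KB => //; apply: LK.
    - move=> x [K FK Kx].
      by have [[/ideal_ofP[_ _ KS _] _] _ _] := F_good K x FK Kx; apply: KS.
    - move=> a x Sa [K FK Kx]; exists K => //.
      by have [[/ideal_ofP[_ _ _ KM] _] _ _] := F_good K x FK Kx; apply: KM.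
    - move=> x [K FK Kx]; have [[_ grK] _ _] := F_good K x FK Kx.
      have [s [c [us sK xE]]] := grK x Kx; exists s, c; split=> // a /sK[Kc ac].
      by split=> //; exists K.
  by move=> [K FK K1]; have [] := F_good K 1 FK K1.
have [grI0 IS] := grI.
have I0 : I 0 by have /ideal_ofP[] := grI0.
case: Mgood => [M0|[grM nM1 IM]].
  case: (Mmax I); last by right; split.
  by rewrite M0; split=> // h; have := h 0 I0.
exists M => //; split=> //; first by apply/(ideal_proper (proj1 grM)).
move=> J grJ JS MJ; apply: contrapT => JM; apply: (Mmax J).
  by split=> // JsubM; apply: JM; apply/seteqP; split.
right; split=> //; last exact: subset_trans MJ.
by apply/(ideal_proper (proj1 grJ)).
Qed.

End GradedIdeals.

(** * Homogeneous localization at a graded prime *)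

Section HomogeneousLocalization.
Variables (G : zmodType) (R : idomainType) (gr : grading G R).
Variables (S P : set {fraction R}).
Hypotheses (Sover : graded_overring gr S) (Pprime : hSpec gr S P).

(** The denominators of the homogeneous localization of [S] at [P]. *)
Definition hdenom : set {fraction R} :=
  [set t | [/\ S t, ~ P t & exists a, qcomp gr a t]].

(** The extension of [I] to the homogeneous localization: [hfrac S] is the
    localization itself, and [hfrac P] will be its graded maximal ideal. *)
Definition hfrac (I : set {fraction R}) : set {fraction R} :=
  [set x | exists p t, [/\ I p, hdenom t & x = p / t]].

Lemma overring1 : S 1.
Proof. by case: Sover => [[+ _ _] _ _ _]; rewrite inE. Qed.

Lemma overringM x y : S x -> S y -> S (x * y).
Proof.
by case: Sover => [[_ _ h] _ _ _] Sx Sy; have := h x y; rewrite !inE; apply.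
Qed.

Lemma overring_ideal : graded_ideal gr S S.
Proof.
case: Sover => [[S1 SB SM] _ _ grS]; split=> //; apply/ideal_ofP; split=> //.
- by rewrite -(subrr 1); have := SB 1 1 S1 S1; rewrite inE.
- by move=> x y Sx Sy; have := SB x y; rewrite !inE; apply.
- exact: overringM.
Qed.

Lemma prime_ideal : graded_ideal gr S P. Proof. by case: Pprime. Qed.

Lemma prime_not1 : ~ P 1.
Proof.
have [[idP _] PS _] := Pprime.
by have [h _] := ideal_proper overring1 idP; apply: h.
Qed.

Lemma hdenom1 : hdenom 1.
Proof.
by split; [exact: overring1 | exact: prime_not1 | exists 0; apply: qcomp1].
Qed.

Lemma hdenomM t u : hdenom t -> hdenom u -> hdenom (t * u).
Proof.
move=> [St Pt [a at']] [Su Pu [b bu]]; split; first exact: overringM.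
  by case: Pprime => _ _ primeP /(primeP _ _ St Su)[].
by exists (a + b); apply: qcompM.
Qed.

Lemma hdenom_neq0 t : hdenom t -> t != 0.
Proof.
move=> [_ Pt _]; apply: contra_notN Pt => /eqP->.
by have [/ideal_ofP[]] := prime_ideal.
Qed.

Lemma hfrac_incl I x : I x -> hfrac I x.
Proof. by move=> Ix; exists x, 1; split; rewrite ?divr1//; apply: hdenom1. Qed.

Lemma hfrac_mono I J : I `<=` J -> hfrac I `<=` hfrac J.
Proof. by move=> IJ _ [p [t [Ip Dt ->]]]; exists p, t; split=> //; apply: IJ. Qed.

Lemma hfracV t : hdenom t -> hfrac S t^-1.
Proof. by move=> Dt; exists 1, t; split; rewrite ?div1r//; apply: overring1. Qed.

Lemma hfracM I x y : (forall a z, S a -> I z -> I (a * z)) ->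
  hfrac S x -> hfrac I y -> hfrac I (x * y).
Proof.
move=> IM [s [t [Ss Dt ->]]] [p [u [Ip Du ->]]].
exists (s * p), (t * u); split; [exact: IM | exact: hdenomM |].
by rewrite invfM mulrACA.
Qed.

Lemma hfracB I x y : ideal_of S I -> hfrac I x -> hfrac I y -> hfrac I (x - y).
Proof.
move=> /ideal_ofP[_ IB _ IM] [p [t [Ip Dt ->]]] [q [u [Iq Du ->]]].
exists (u * p - t * q), (t * u); split; last 1 first.
- rewrite -mulNr addf_div ?hdenom_neq0// mulNr.
  by rewrite [p * u]mulrC [q * t]mulrC.
- by case: Dt Du => [St _ _] [Su _ _]; apply: IB; apply: IM.
- exact: hdenomM.
Qed.

Lemma hfrac_graded I : is_graded_subset (qcomp gr) I ->
  is_graded_subset (qcomp gr) (hfrac I).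
Proof.
move=> grI _ [p [t [Ip Dt ->]]]; have [_ _ [b bt]] := Dt.
have [s [c [us sI ->]]] := grI p Ip.
exists [seq a - b | a <- s], (fun e => c (e + b) / t); split.
- by rewrite map_inj_uniq//; apply: addIr.
- move=> _ /mapP[a a_s ->]; rewrite subrK; have [Ica aca] := sI a a_s; split.
    by exists (c a), t.
  exact: qcomp_div (hdenom_neq0 Dt) aca bt.
- by rewrite big_map mulr_suml; apply: eq_bigr => a _; rewrite subrK.
Qed.

Lemma hfrac_ideal I : graded_ideal gr S I -> graded_ideal gr (hfrac S) (hfrac I).
Proof.
move=> [idI grI]; have /ideal_ofP[I0 IB IS IM] := idI.
split; last exact: hfrac_graded.
apply/ideal_ofP; split.
- exact: hfrac_incl.
- by move=> x y; apply: hfracB.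
- exact: hfrac_mono.
- by move=> a x; apply: hfracM.
Qed.

(** If [x = p / t] then [x * t] is in [I], and [t] is not, being outside [P]. *)
Lemma hfrac_contract I x : hSpec gr S I -> I `<=` P ->
  S x -> hfrac I x -> I x.
Proof.
move=> [[/ideal_ofP[_ _ IS _] _] _ primeI] IP Sx [p [t [Ip Dt xE]]].
have [St Pt _] := Dt.
have [||/IP//] // := primeI x t Sx St.
by rewrite xE divfK// hdenom_neq0.
Qed.

Lemma hfrac_prime I : hSpec gr S I -> I `<=` P ->
  hSpec gr (hfrac S) (hfrac I).
Proof.
move=> Iprime IP; have [grI IneS primeI] := Iprime.
split; first exact: hfrac_ideal.
  move=> IS; apply: prime_not1; apply: (IP); apply: (hfrac_contract Iprime IP).
    exact: overring1.
  by rewrite IS; apply: hfrac_incl; apply: overring1.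
move=> _ _ [x [t [Sx Dt ->]]] [y [u [Sy Du ->]]] xyI.
have [St Pt _] := Dt; have [Su Pu _] := Du.
have Ixy : I (x * y).
  apply: hfrac_contract => //; first exact: overringM.
  have -> : x * y = (t * u) * (x / t * (y / u)).
    by rewrite [RHS]mulrC mulrACA !divfK// hdenom_neq0.
  apply: hfracM xyI; first by case: grI => /ideal_ofP[].
  by apply: hfrac_incl; apply: overringM.
by case: (primeI x y Sx Sy Ixy) => [Ix|Iy]; [left; exists x, t|right; exists y, u].
Qed.

Lemma hfrac_overring : graded_overring gr (hfrac S).
Proof.
have [_ RS SQ grS] := Sover; have [idS _] := overring_ideal.
split.
- split; first by rewrite inE; apply: hfrac_incl; apply: overring1.
    by move=> x y; rewrite !inE; apply: hfracB.
  by move=> x y; rewrite !inE; apply: hfracM; apply: overringM.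
- by move=> x /RS; apply: hfrac_incl.
- move=> _ [p [t [/SQ[r [h [h0 [a ah] ->]]] Dt ->]]].
  have t0 := hdenom_neq0 Dt.
  have [_ _ [b [b1 [b2 [f [g [bf bg g0 bE tE]]]]]]] := Dt.
  exists (r * g), (h * f); split.
  + rewrite mulf_neq0//; apply: contraNneq t0 => f0.
    by rewrite tE f0 tofrac0 mul0r.
  + by exists (a + b1); apply: gr_mul.
  + by rewrite tE !tofracM invf_div mulf_div.
- exact: hfrac_graded.
Qed.

(** A homogeneous element [p / t] lying outside [hfrac P] has [p] homogeneous
    and outside [P], hence is a unit of [hfrac S]. *)
Lemma hfrac_proper_sub I : graded_ideal gr (hfrac S) I -> I <> hfrac S ->
  I `<=` hfrac P.
Proof.
move=> [idI grI] IneS x /grI[s [c [_ sI ->]]].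
have S1 : hfrac S 1 by apply: hfrac_incl; apply: overring1.
have [h _] := ideal_proper S1 idI; have nI1 := h IneS.
have /ideal_ofP[_ _ IS IM] := idI.
have [idP _] := hfrac_ideal prime_ideal; have /ideal_ofP[P0 PB _ _] := idP.
rewrite big_seq; apply: big_ind => [//|u v Pu Pv|a /sI[Ica aca]].
  by rewrite -[v]opprK -[- v]add0r; apply: (PB) => //; apply: PB.
have [p [t [Sp Dt cE]]] := IS _ Ica; exists p, t; split=> //.
have [St Pt [b bt]] := Dt; have t0 := hdenom_neq0 Dt.
apply: contrapT => nPp; apply: nI1.
have Dp : hdenom p.
  by split=> //; exists (a + b); rewrite -[p](divfK t0) -cE; apply: qcompM.
have -> : 1 = (t / p) * c a.
  by rewrite cE mulrA divfK ?hdenom_neq0// divff.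
by apply: IM => //; exists t, p.
Qed.

Lemma hfrac_maximal M : graded_maximal gr (hfrac S) M <-> M = hfrac P.
Proof.
have [grP PneS _] := hfrac_prime Pprime (@subset_refl _ P).
split=> [[grM MneS maxM]|->].
  by apply/esym/maxM => //; apply: hfrac_proper_sub.
split=> // I grI IneS PI; apply/seteqP; split=> //.
exact: hfrac_proper_sub.
Qed.

Lemma hfrac_local : gr_local gr (hfrac S).
Proof.
exists (hfrac P); split; first exact/hfrac_maximal.
by move=> M /hfrac_maximal.
Qed.

(** Going-down for [hfrac S] is going-down for [S] under the correspondence
    between the graded primes of [hfrac S] and those of [S] inside [P]. *)
Lemma hfrac_gGD : gGD gr S -> gGD gr (hfrac S).
Proof.
have [_ RS _ grS] := Sover.
move=> gdS P0 Q0 Q' P0prime Q0prime Q'prime PQ Q'R.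
have [[idQ' grQ'] Q'ne primeQ'] := Q'prime.
have /ideal_ofP[Q'0 Q'B Q'S Q'M] := idQ'.
have S1 := overring1.
have T1 : hfrac S 1 by apply: hfrac_incl.
have [h _] := ideal_proper T1 idQ'; have nQ'1 := h Q'ne.
have [/ideal_ofP[S0 SB _ SM] _] := overring_ideal.
have idQS : ideal_of S (Q' `&` S).
  apply/ideal_ofP; split=> //.
  - by move=> x y [Qx Sx] [Qy Sy]; split; [apply: Q'B|apply: SB].
  - by move=> a x Sa [Qx Sx]; split; [apply: Q'M => //; apply: hfrac_incl|apply: SM].
have QSprime : hSpec gr S (Q' `&` S).
  split.
  - split=> //; apply: graded_subsetI => //; [exact: qcomp_zmod|].
    exact: qcomp_direct.
  - by apply/(ideal_proper S1 idQS) => -[].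
  - by move=> x y Sx Sy [/primeQ' []]; [exact: hfrac_incl..|left|right].
have QSR : (Q' `&` S) `&` base_ring R = Q0.
  by rewrite -setIA (setIidr RS).
have [P' [P'prime P'Q P'R]] := gdS P0 Q0 _ P0prime Q0prime QSprime PQ QSR.
have QSP : Q' `&` S `<=` P.
  move=> x [Qx Sx]; apply: hfrac_contract => //.
  by apply: (hfrac_proper_sub (I := Q')).
have P'P := subset_trans P'Q QSP.
exists (hfrac P'); split; first exact: hfrac_prime.
  move=> _ [p [t [/P'Q[Qp _] Dt ->]]].
  by rewrite mulrC; apply: Q'M => //; apply: hfracV.
rewrite -P'R; apply/seteqP; split=> x [P'x Rx]; split=> //.
  by apply: hfrac_contract => //; apply: RS.
exact: hfrac_incl.
Qed.

End HomogeneousLocalization.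

(** * Homogeneous units *)

(** Otherwise [w] generates a proper graded ideal, contained in a graded maximal
    ideal, and [m] is the only one. *)
Lemma homogeneous_unit (G : zmodType) (R : idomainType) (gr : grading G R)
    (m : set {fraction R}) (a : G) (w : R) :
  gr_local gr (base_ring R) -> graded_maximal gr (base_ring R) m ->
  gr a w -> ~ m w%:F -> exists v, v * w = 1.
Proof.
move=> [m' [_ uniq_m]] maxm aw mw; apply: contrapT => nunit.
pose I : set {fraction R} := [set x | exists r : R, x = (r * w)%:F].
have R1 : base_ring R 1 by exists 1; rewrite ?tofrac1.
have grI : graded_ideal gr (base_ring R) I.
  split; first apply/ideal_ofP; first split.
  - by exists 0; rewrite mul0r tofrac0.
  - by move=> _ _ [r ->] [s ->]; exists (r - s); rewrite mulrBl tofracB.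
  - by move=> _ [r ->]; exists (r * w).
  - by move=> _ _ [s _ <-] [r ->]; exists (s * r); rewrite -tofracM mulrA.
  - move=> _ [r ->]; have [s [c [us sc ->]]] := gr_decomp gr r.
    exists [seq b + a | b <- s], (fun e => (c (e - a) * w)%:F); split.
    + by rewrite map_inj_uniq//; apply: addIr.
    + move=> _ /mapP[b /sc[bc _] ->]; rewrite addrK; split; first by exists (c b).
      by apply: qcomp_tofrac; apply: gr_mul.
    + rewrite big_map mulr_suml rmorph_sum; apply: eq_bigr => b _.
      by rewrite /= addrK.
have [|M maxM IM] := exists_graded_maximal R1 grI.
  move=> [r /eqP]; rewrite -tofrac1 tofrac_eq => /eqP rw.
  by apply: nunit; exists r.
apply: mw; rewrite -(uniq_m m maxm) (uniq_m M maxM); apply: IM.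
by exists 1; rewrite mul1r.
Qed.

(** * Going-down overrings with a graded prime over [m] *)

Theorem proposition2p15 (G : zmodType) (R : idomainType) (gr : grading G R)
    (m S : set {fraction R}) :
  torsion_free G ->
  gr_local gr (base_ring R) -> graded_maximal gr (base_ring R) m ->
  graded_perinormal gr ->
  graded_overring gr S -> gGD gr S ->
  (exists P, hSpec gr S P /\ P `&` base_ring R = m) ->
  S = base_ring R.
Proof.
move=> tfG locR maxm perR Sover gdS [P [Pprime PR]].
have [_ RS _ _] := Sover.
have Tover := hfrac_overring Sover Pprime.
have [W [[_ W0] TE]] := perR _ Tover
  (hfrac_local Sover Pprime) (hfrac_gGD Sover Pprime gdS).
apply/seteqP; split=> // x Sx.
have : localization W x by rewrite -TE; apply: hfrac_incl.
move=> [r [w [Ww ->]]].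
have w0 : w%:F != 0 by rewrite tofrac_eq0; apply: contra_notN W0 => /eqP<-.
have Tw : hfrac gr S P S w%:F^-1.
  by rewrite TE; exists 1, w; rewrite tofrac1 div1r.
have [a aw] : exists a, gr a w.
  have [_ _ TQ _] := Tover; have [r' [h [h0 [d dh] e]]] := TQ _ Tw.
  have wr' : w * r' = h.
    have hF0 : h%:F != 0 by rewrite tofrac_eq0.
    apply/eqP; rewrite -tofrac_eq tofracM -[r'%:F](divfK hF0) -e.
    by rewrite mulrA divff// mul1r.
  by apply: (homogeneous_factor (y := r') (d := d)) => //; rewrite wr'.
have nmw : ~ m w%:F.
  rewrite -PR => -[Pw _].
  have TP1 : hfrac gr S P P 1.
    rewrite -(mulVf w0); apply: (hfracM Sover Pprime) Tw _.
      by have [/ideal_ofP[]] := prime_ideal Pprime.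
    exact: hfrac_incl.
  apply: (prime_not1 Sover Pprime).
  exact (hfrac_contract Pprime Pprime (@subset_refl _ P) (overring1 Sover) TP1).
have [v vw] := homogeneous_unit locR maxm aw nmw.
exists (r * v) => //; apply: (mulIf w0).
by rewrite divfK// -tofracM -mulrA vw mulr1.
Qed.
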